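(* Let $\mathbf G$ be a (split) semisimple group, $Q:Y\to\mathbf Z$ a Weyl-invariant quadratic form on its cocharacter lattice, and for $n\ge1$ let $b_{W,n}=|(\mathscr X_{Q,n})^W|$. (i) One has $b_{W,n}\le|\pi_1(\overline G_{Q,n}^\vee)|$, where $\pi_1(\overline G_{Q,n}^\vee)$ is the fundamental group of the dual group $\overline G_{Q,n}^\vee$ of the $n$-fold cover $\overline G$. (ii) If $\mathbf G$ is simply-connected, then $b_{W,n}\le1$ for every $n$. (iii) If $\mathbf G$ is of adjoint type, then $b_{W,n}=|\pi_1(\overline G_{Q,n}^\vee)|$ for all $n$. (iv) For fixed $(\mathbf G,Q)$ with $\mathbf G$ almost-simple, $b_{W,n}$ is periodic as a function of $n\in\mathbf N$: there is a natural number $c=c(\mathbf G,Q)\ge1$ depending only on $\mathbf G$ and $Q$ such that $b_{W,n}=b_{W,n+c}$ for every $n\in\mathbf N$. Such periodicity is compatible with that of the dual group $\overline G_{Q,n}^\vee$ for varying $n$, the latter being the fact that, for $\mathbf G$ semisimple and $Q$ fixed, there is a number $c'=c'(\mathbf G,Q)\in\mathbf N$ with $\overline G_{Q,n}^\vee\simeq\overline G_{Q,n+c'}^\vee$ for all $n$.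
   Context: $(X,\Phi,\Delta;Y,\Phi^\vee,\Delta^\vee)$ is the root datum of $\mathbf G$ ($X$ characters, $Y$ cocharacters of a split maximal torus), $W$ its Weyl group, acting on $Y\otimes\mathbf Q$. $\overline G$ denotes an $n$-fold Brylinski–Deligne central cover, attached to $Q$, of the group $G$ of rational points of $\mathbf G$ over a $p$-adic field. $B_Q(x,y)=Q(x+y)-Q(x)-Q(y)$. For $n\ge1$: $Y_{Q,n}=\{y\in Y:B_Q(y,y')\in n\mathbf Z\text{ for all }y'\in Y\}$, $n_\alpha=n/\gcd(n,Q(\alpha^\vee))$, $\alpha_{Q,n}^\vee=n_\alpha\alpha^\vee$, $\alpha_{Q,n}=\alpha/n_\alpha$, and $Y_{Q,n}^{sc}$ is the lattice spanned by all $\alpha_{Q,n}^\vee$. Let $\rho=\frac12\sum_{\alpha>0}\alpha^\vee$. $W$ acts on $Y$ by the twisted action $w[y]=w(y-\rho)+\rho$, which descends to $\mathscr X_{Q,n}=Y/Y_{Q,n}$; $(\mathscr X_{Q,n})^W$ is the set of points fixed by this twisted action. The dual group $\overline G_{Q,n}^\vee$ of $\overline G$ is the complex reductive group with root datum $(Y_{Q,n},\{\alpha_{Q,n}^\vee\};\mathrm{Hom}(Y_{Q,n},\mathbf Z),\{\alpha_{Q,n}\})$, with $Y_{Q,n}$ the character lattice and $\alpha_{Q,n}^\vee$ the roots. For $\mathbf G$ semisimple its (algebraic) fundamental group satisfies $\pi_1(\overline G_{Q,n}^\vee)\simeq P(Y_{Q,n}^{sc})/Y_{Q,n}$, where $P(Y_{Q,n}^{sc})=\{v\in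 Y\otimes\mathbf Q:\langle v,\alpha_{Q,n}\rangle\in\mathbf Z\ \forall\alpha\in\Phi\}$ is the weight lattice. *)

(* Defs.v *)
From HB Require Import structures.
From mathcomp Require Import all_boot all_order all_algebra.
From mathcomp Require Import finmap.
From mathcomp Require Import boolp classical_sets functions cardinality.

Set Implicit Arguments.
Unset Strict Implicit.
Unset Printing Implicit Defensive.

Import Order.TTheory GRing.Theory Num.Theory.
Local Open Scope classical_set_scope.
Local Open Scope ring_scope.

(* The character and cocharacter lattices X and Y of a rank r torus are        *)
(* full-rank lattices in X (x) Q and Y (x) Q, both identified with Q^r so that *)
(* the canonical pairing is the dot product; X and Y need not be Z^r.  This    *)
(* lets a lattice, its sublattices and the overlattice of weights live in one  *)
(* ambient space.                                                              *)

Definition pairing (r : nat) (x y : 'rV[rat]_r) : rat := (x *m y^T) 0 0.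

Definition zspan (r : nat) (I : finType) (f : I -> 'rV[rat]_r) :
    set 'rV[rat]_r :=
  [set v | exists c : I -> int, v = \sum_i f i *~ c i].

Definition is_lattice (r : nat) (L : set 'rV[rat]_r) : Prop :=
  exists2 E : 'M[rat]_r, E \in unitmx & L = zspan (fun i => row i E).

(* Identified with Hom(L, Z) when L is a full-rank lattice. *)
Definition dual_lattice (r : nat) (L : set 'rV[rat]_r) : set 'rV[rat]_r :=
  [set y | forall x, L x -> pairing x y \is a Num.int].

(* Cosets of B contained in A: the quotient A / B of subgroups B <= A. *)
Definition cosets (r : nat) (A B : set 'rV[rat]_r) : set (set 'rV[rat]_r) :=
  [set [set a + b | b in B] | a in A].

Definition card (r : nat) (S : set (set 'rV[rat]_r)) : nat :=
  #|` fset_set S|.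

(* The data only; the axioms are in is_root_datum. The bijection between roots *)
(* and coroots is given by a common index type.                                *)
Record rootDatum (r : nat) := RootDatum {
  charLat : set 'rV[rat]_r;
  cocharLat : set 'rV[rat]_r;
  rootIdx : finType;
  root : rootIdx -> 'rV[rat]_r;
  coroot : rootIdx -> 'rV[rat]_r
}.

Section RootDatum.
Variables (r : nat) (D : rootDatum r).
Local Notation V := 'rV[rat]_r.
Local Notation I := (rootIdx D).

Definition refl_char (i : I) (x : V) : V :=
  x - pairing x (coroot i) *: root i.

Definition refl_cochar (i : I) (y : V) : V :=
  y - pairing (root i) y *: coroot i.

Record is_root_datum : Prop := IsRootDatum {
  charLat_lattice : is_lattice (charLat D);
  cocharLat_dual : cocharLat D = dual_lattice (charLat D);
  root_char : forall i : I, charLat D (root i);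
  coroot_cochar : forall i : I, cocharLat D (coroot i);
  root_inj : injective (@root r D);
  coroot_inj : injective (@coroot r D);
  root_coroot : forall i : I, pairing (root i) (coroot i) = 2;
  refl_char_root : forall i j : I, exists k : I, root k = refl_char i (root j);
  refl_cochar_coroot :
    forall i j : I, exists k : I, coroot k = refl_cochar i (coroot j);
  root_reduced : forall (i j : I) (c : rat),
    root j = c *: root i -> c = 1 \/ c = -1
}.

Definition semisimple : Prop := <<codom (@root r D)>>%VS = fullv.

Definition simply_connected : Prop := cocharLat D = zspan (@coroot r D).

Definition adjoint_type : Prop := charLat D = zspan (@root r D).

(* Among semisimple root data, those of the almost-simple groups. *)
Definition irreducible : Prop :=
  (0 < #|I|)%N /\
  forall J : {set I},
    (forall i j : I, i \in J -> j \notin J -> pairing (root i) (coroot j) = 0) ->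
    J = finset.set0 \/ J = [set: I]%SET.

Inductive weyl : (V -> V) -> Prop :=
| weyl_id : weyl (fun y => y)
| weyl_refl (i : I) (w : V -> V) : weyl w -> weyl (fun y => refl_cochar i (w y)).

Definition positive (Delta : {set I}) (i : I) : Prop :=
  exists c : I -> nat, root i = \sum_(j in Delta) root j *+ c j.

Definition is_base (Delta : {set I}) : Prop :=
  free [seq root i | i in Delta] /\
  forall i : I, positive Delta i \/
    exists2 j : I, positive Delta j & root i = - root j.

Definition rho (Delta : {set I}) : V :=
  2^-1 *: \sum_(i | `[< positive Delta i >]) coroot i.

Definition twisted (Delta : {set I}) (w : V -> V) (y : V) : V :=
  w (y - rho Delta) + rho Delta.

Definition weight_lattice : set V :=
  [set v | forall i : I, pairing v (coroot i) \is a Num.int].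

(* Order of the algebraic fundamental group of the semisimple group with root  *)
(* datum D, in the form (weights of D) / (characters of D).                    *)
Definition pi1_order : nat := card (cosets weight_lattice (charLat D)).

(* Q is only meaningful on cocharLat D; its values elsewhere are irrelevant.   *)
Section QuadraticForm.
Variable Q : V -> int.

Definition polar (x y : V) : int := Q (x + y) - Q x - Q y.

Definition is_quadratic_form : Prop :=
  (forall (k : int) (y : V), cocharLat D y -> Q (y *~ k) = k ^+ 2 * Q y) /\
  (forall x y z : V, cocharLat D x -> cocharLat D y -> cocharLat D z ->
     polar (x + y) z = polar x z + polar y z).

Definition weyl_invariant : Prop :=
  forall w : V -> V, weyl w -> forall y : V, cocharLat D y -> Q (w y) = Q y.

Definition YQn (n : nat) : set V :=
  [set y | cocharLat D y /\
           forall y', cocharLat D y' -> (n%:Z %| polar y y')%Z].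

Definition n_root (n : nat) (i : I) : nat :=
  (n %/ gcdn n `|Q (coroot i)|)%N.

(* Root datum of the dual group of the n-fold cover. *)
Definition dual_datum (n : nat) : rootDatum r :=
  RootDatum (YQn n) (dual_lattice (YQn n))
    (fun i : I => (n_root n i)%:R *: coroot i)
    (fun i : I => (n_root n i)%:R^-1 *: root i).

(* The points of Y / Y_{Q,n} fixed by W, which acts on cosets through the      *)
(* image of a set under the twisted action.                                    *)
Definition XQn_fixed (Delta : {set I}) (n : nat) : set (set V) :=
  [set C | cosets (cocharLat D) (YQn n) C /\
           forall w, weyl w -> twisted Delta w @` C = C].

Definition bW (Delta : {set I}) (n : nat) : nat := card (XQn_fixed Delta n).

End QuadraticForm.
End RootDatum.

(* Isomorphism of root data, which by the classification of complex reductive  *)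
(* groups is the same as isomorphism of the groups: an isomorphism f of the    *)
(* character lattices with transpose g, matching roots and coroots through a   *)
(* bijection s.                                                                *)
Definition rootDatum_iso (r r' : nat) (D : rootDatum r) (D' : rootDatum r') :
    Prop :=
  exists (f : 'rV[rat]_r -> 'rV[rat]_r') (g : 'rV[rat]_r' -> 'rV[rat]_r)
         (s : rootIdx D -> rootIdx D'),
    [/\ set_bij (charLat D) (charLat D') f,
        set_bij (cocharLat D') (cocharLat D) g,
        bijective s &
    [/\ forall x x', charLat D x -> charLat D x' -> f (x + x') = f x + f x',
        forall y y', cocharLat D' y -> cocharLat D' y' -> g (y + y') = g y + g y',
        forall x y, charLat D x -> cocharLat D' y ->
          pairing (f x) y = pairing x (g y),
        forall i, f (root i) = root (s i) &
        forall i, g (coroot (s i)) = coroot i]].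

(* Main.v *)
Require Import Defs.
From HB Require Import structures.
From mathcomp Require Import all_boot all_order all_algebra.
From mathcomp Require Import finmap.
From mathcomp Require Import boolp classical_sets functions cardinality.
From mathcomp Require Import ring lra.
Import Order.TTheory GRing.Theory Num.Theory.

(** Write B for the polar form of [Q] and q_a for the value of [Q] at the coroot
of a. Weyl invariance gives B(y, a^) = <a, y> q_a ([polar_alphav]), so
everything about Y_{Q,n} can be read off the pairings with the roots.

A coset y + Y_{Q,n} is fixed by the twisted action as soon as it is fixed by the
reflections, which means that <a, y - rho> a^ lies in Y_{Q,n} for every root a
([XQn_fixedE]). The central point is that the difference of two solutions is a
weight of the dual group, that is, n_a divides <a, y - y'>
([fixed_reps_sub]). If a takes an odd value on Y, this holds because the
equation for y says exactly that n_a divides <a, y - rho>. If a is divisible by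
2 in X, the equation only gives this up to a factor 2; one then uses that
<a, rho> is odd ([rho_pairing]), which makes the two terms <a, y - rho> odd and
their difference even, so that the spare factor 2 goes into the difference.

Subtracting one solution therefore embeds the fixed points into P / Y_{Q,n}:
this bounds their number. If Y is spanned by the coroots, a cocharacter all of whose
pairings <a, y> are divisible by n_a is in Y_{Q,n}, so two solutions are
congruent. If X is spanned by the roots, then P lies in Y and rho
itself is a solution, so that the solutions are exactly rho + P.

For the periodicity, V is the sum of the span of the coroots with q_a = 0 and of
the span of the others, and these are orthogonal to each other. Let F be the
identity on the first and the multiplication by t = (n + c) / n on the second.
If c is a suitable multiple of all the nonzero q_a, then v F - v is a
cocharacter when v is in Y_{Q,n} or is y - rho for a solution y ([scaling_displacement]). Consequently F maps
Y_{Q,n} onto Y_{Q,n+c} and n_a a^ to (n+c)_a a^, so it is an isomorphism of the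
dual root data, and y |-> (y - rho) F + rho carries the fixed points modulo n to
the fixed points modulo n + c. Both periodicities thus hold with the same c.

The axioms of a root datum do not mention that the coroots span, nor that
the bijection between roots and coroots is compatible with reflections. Both
follow from the invariant positive definite form sum_a <a, y> <a, y'>. *)

(** * The pairing, and rational coordinates along a spanning family *)

Section Pairing.
Set Implicit Arguments.
Unset Strict Implicit.
Local Open Scope ring_scope.
Variable r : nat.
Implicit Types x y z : 'rV[rat]_r.

Lemma pairingE x y : pairing x y = \sum_j x 0 j * y 0 j.
Proof. by rewrite /pairing mxE; apply: eq_bigr => j _; rewrite mxE. Qed.

Lemma pairingC x y : pairing x y = pairing y x.
Proof. by rewrite !pairingE; apply: eq_bigr => j _; rewrite mulrC. Qed.

Lemma pairingDr x y z : pairing x (y + z) = pairing x y + pairing x z.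
Proof. by rewrite /pairing linearD mulmxDr mxE. Qed.

Lemma pairingZr a x y : pairing x (a *: y) = a * pairing x y.
Proof. by rewrite /pairing linearZ -scalemxAr mxE. Qed.

Lemma pairingNr x y : pairing x (- y) = - pairing x y.
Proof. by rewrite -scaleN1r pairingZr mulN1r. Qed.

Lemma pairingBr x y z : pairing x (y - z) = pairing x y - pairing x z.
Proof. by rewrite pairingDr pairingNr. Qed.

Lemma pairing0r x : pairing x 0 = 0.
Proof. by rewrite -(subrr x) pairingBr subrr. Qed.

Lemma pairing_sumr (J : Type) (s : seq J) (P : pred J) (F : J -> 'rV[rat]_r) x :
  pairing x (\sum_(j <- s | P j) F j) = \sum_(j <- s | P j) pairing x (F j).
Proof.
elim/big_rec2: _ => [|j u v _ <-]; first exact: pairing0r.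
by rewrite pairingDr.
Qed.

Lemma pairingZl a x y : pairing (a *: x) y = a * pairing x y.
Proof. by rewrite pairingC pairingZr pairingC. Qed.

Lemma pairingNl x y : pairing (- x) y = - pairing x y.
Proof. by rewrite pairingC pairingNr pairingC. Qed.

Lemma pairingBl x y z : pairing (x - y) z = pairing x z - pairing y z.
Proof. by rewrite pairingC pairingBr !(pairingC z). Qed.

Lemma pairing_suml (J : Type) (s : seq J) (P : pred J) (F : J -> 'rV[rat]_r) y :
  pairing (\sum_(j <- s | P j) F j) y = \sum_(j <- s | P j) pairing (F j) y.
Proof.
by rewrite pairingC pairing_sumr; apply: eq_bigr => j _; rewrite pairingC.
Qed.

Lemma pairing_tr (A : 'M[rat]_r) x y :
  pairing (x *m A) y = pairing x (y *m A^T).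
Proof. by rewrite /pairing trmx_mul trmxK mulmxA. Qed.

Lemma pairing_delta x j : pairing x (delta_mx 0 j) = x 0 j.
Proof.
rewrite pairingE (bigD1 j) //= mxE !eqxx mulr1 big1 ?addr0 // => k kj.
by rewrite mxE (negbTE kj) mulr0.
Qed.

Lemma pairing_nondegenerate x y :
  (forall z, pairing x z = pairing y z) -> x = y.
Proof. by move=> xy; apply/rowP => j; rewrite -!pairing_delta. Qed.

Lemma span_coef (J : finType) (f : J -> 'rV[rat]_r) v :
  v \in <<codom f>>%VS -> exists c : J -> rat, v = \sum_j c j *: f j.
Proof.
move=> /(@coord_span _ _ _ (codom_tuple f)) {1}->.
exists (fun j => coord (codom_tuple f) (enum_rank j) v).
rewrite (reindex_onto (@enum_rank J) (@enum_val J J)) /=; last first.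
  by move=> i _; rewrite enum_valK.
rewrite (eq_bigl xpredT) => [|j]; last by rewrite enum_rankK eqxx.
apply: eq_bigr => j _; congr (_ *: _).
by rewrite /= (nth_codom 0 f (enum_rank j)) enum_rankK.
Qed.

Lemma common_denominator (J : finType) (c : J -> rat) :
  exists2 k : nat, (0 < k)%N & forall j, k%:R * c j \is a Num.int.
Proof.
exists (\prod_j `|denq (c j)|)%N.
  by rewrite prodn_gt0 // => j; rewrite absz_gt0 denq_neq0.
move=> j; rewrite (bigD1 j) //= natrM mulrAC rpredM ?rpred_nat //.
by rewrite natr_absz /= normr_denq mulrC -numqE intr_int.
Qed.

Lemma zspan_multiple (J : finType) (f : J -> 'rV[rat]_r) v :
  <<codom f>>%VS = fullv -> exists2 k : nat, (0 < k)%N & zspan f (k%:R *: v).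
Proof.
move=> fV; have /span_coef[c ->] : v \in <<codom f>>%VS by rewrite fV memvf.
have [k k0 ck] := common_denominator c.
have /choice[m cm] : forall j, exists m : int, k%:R * c j = m%:~R.
  by move=> j; apply/intrP.
exists k => //; exists m; rewrite scaler_sumr; apply: eq_bigr => j _.
by rewrite scalerA -scaler_int cm.
Qed.

End Pairing.

(** * Counting cosets *)

Section Cosets.
Set Implicit Arguments.
Unset Strict Implicit.
Local Open Scope ring_scope.
Local Open Scope classical_set_scope.
Local Open Scope card_scope.
Variable r : nat.
Local Notation V := 'rV[rat]_r.
Implicit Types (A B : set V) (x y : V).

Definition subgroup B := B 0 /\ forall x y, B x -> B y -> B (x - y).

Lemma subgroupN B x : subgroup B -> B x -> B (- x).
Proof. by case=> B0 BB Bx; rewrite -sub0r; apply: BB. Qed.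

Lemma subgroupD B x y : subgroup B -> B x -> B y -> B (x + y).
Proof.
by move=> sB Bx By; rewrite -[y]opprK; apply: sB.2 => //; apply: subgroupN.
Qed.

Lemma subgroupMz B x (k : int) : subgroup B -> B x -> B (x *~ k).
Proof.
move=> sB Bx; have natB n : B (x *+ n).
  elim: n => [|n IH]; first by rewrite mulr0n; case: sB.
  by rewrite mulrS; apply: subgroupD.
case: k => n; first exact: natB.
by rewrite NegzE mulrNz; apply: subgroupN => //; apply: natB.
Qed.

Lemma subgroupZ B x (a : rat) :
  subgroup B -> a \is a Num.int -> B x -> B (a *: x).
Proof. by move=> sB /intrP[k ->] Bx; rewrite scaler_int; apply: subgroupMz. Qed.

Lemma subgroup_zspan B (J : finType) (f : J -> V) :
  subgroup B -> (forall j, B (f j)) -> zspan f `<=` B.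
Proof.
move=> sB Bf _ [c ->]; elim/big_ind: _ => [|x y|j _]; first by case: sB.
  exact: subgroupD.
exact: subgroupMz.
Qed.

Lemma dual_lattice_subgroup (L : set V) : subgroup (dual_lattice L).
Proof.
split=> [x _|x y Lx Ly z Lz]; first by rewrite pairing0r.
by rewrite pairingBr rpredB ?Lx ?Ly.
Qed.

Lemma coset_eq B x y : subgroup B ->
  [set x + b | b in B] = [set y + b | b in B] <-> B (x - y).
Proof.
move=> sB; split=> [/seteqP[xy _]|Bxy].
  have [b Bb xb] : [set y + b | b in B] x.
    by apply: xy; exists 0; [case: sB|rewrite addr0].
  by rewrite -xb addrC addKr.
apply/seteqP; split=> _ [b Bb <-].
  by exists (x - y + b); [apply: subgroupD|rewrite addrA subrKC].
exists (b - (x - y)); first exact: sB.2.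
by rewrite opprB addrCA subrKC addrC.
Qed.

Lemma cosets_inj (T : Type) (S : set T) A B (f : V -> T) :
  subgroup B -> (forall x, A x -> S (f x)) ->
  (forall x y, A x -> A y -> f x = f y -> B (x - y)) ->
  cosets A B #<= S.
Proof.
move=> sB fS finj.
pose rep (C : set V) := xget 0 [set x | A x /\ [set x + b | b in B] = C].
have repP C : cosets A B C -> A (rep C) /\ [set rep C + b | b in B] = C.
  by case=> a Aa aC; exact: (@xgetPex _ _ [set x | A x /\ [set x + b | b in B] = C] (ex_intro _ a (conj Aa aC))).
apply: (@card_le_trans _ _ _ ((f \o rep) @` cosets A B)); last first.
  by apply: subset_card_le => _ [C /repP[? _] <-]; apply: fS.
have /inj_card_eq : {in cosets A B &, injective (f \o rep)}.
  move=> C C' /set_mem/repP[Ax Cx] /set_mem/repP[Ay Cy] /= fCC.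
  by rewrite -[LHS]Cx -[RHS]Cy; apply/coset_eq => //; apply: finj.
by move=> /card_esym; rewrite card_eq_le => /andP[].
Qed.

Lemma leq_card_set (S S' : set (set V)) :
  finite_set S' -> S #<= S' -> (Defs.card S <= Defs.card S')%N.
Proof.
move=> fS' SS'; have /finite_setP[n Sn] := card_le_finite SS' fS'.
have /finite_setP[m Sm] := fS'.
by rewrite /Defs.card (card_fset_set Sn) (card_fset_set Sm) -card_le_II
  -(card_le_eql Sn) -(card_le_eqr Sm).
Qed.

(** The map is applied to chosen representatives of the cosets, so it need not be
additive: it will be a translation, or a scaling centred at [rho]. *)
Lemma leq_card_cosets A B A' B' (f : V -> V) :
  subgroup B -> subgroup B' -> finite_set (cosets A' B') ->
  (forall x, A x -> A' (f x)) ->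
  (forall x y, A x -> A y -> B' (f x - f y) -> B (x - y)) ->
  (Defs.card (cosets A B) <= Defs.card (cosets A' B'))%N.
Proof.
move=> sB sB' fin AA' finj; apply: leq_card_set => //.
apply: (cosets_inj (f := fun x => [set f x + b | b in B'])) => //.
  by move=> x Ax; exists (f x) => //; apply: AA'.
by move=> x y Ax Ay /coset_eq-/(_ sB'); apply: finj.
Qed.

End Cosets.

(** * Reflections and the invariant form of a semisimple root datum *)

Section RootSystem.
Set Implicit Arguments.
Unset Strict Implicit.
Local Open Scope ring_scope.
Local Open Scope classical_set_scope.
Variables (r : nat) (D : rootDatum r).
Hypotheses (hD : is_root_datum D) (hss : semisimple D).
Local Notation V := 'rV[rat]_r.
Local Notation I := (rootIdx D).
Local Notation Y := (cocharLat D).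
Local Notation alpha := (@Defs.root r D).
Local Notation alphav := (@coroot r D).
Implicit Types (i j k : I) (x y : V).

Lemma cochar_subgroup : subgroup Y.
Proof. by rewrite (cocharLat_dual hD); apply: dual_lattice_subgroup. Qed.

Lemma pairing_cochar_int i y : Y y -> pairing (alpha i) y \is a Num.int.
Proof. by rewrite (cocharLat_dual hD); apply; apply: root_char. Qed.

Lemma pairing_coroot_int i j : pairing (alpha i) (alphav j) \is a Num.int.
Proof. by apply: pairing_cochar_int; apply: coroot_cochar. Qed.

Lemma pairing_refl i x y :
  pairing (refl_char i x) y = pairing x (refl_cochar i y).
Proof.
by rewrite /refl_char /refl_cochar pairingBl pairingBr pairingZl pairingZr mulrC.
Qed.

Lemma refl_cocharK i : involutive (@refl_cochar r D i).
Proof.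
move=> y; have sy : pairing (alpha i) (refl_cochar i y) = - pairing (alpha i) y.
  rewrite pairingBr pairingZr root_coroot // mulr_natr mulr2n opprD addrA.
  by rewrite subrr sub0r.
by rewrite {1}/refl_cochar sy scaleNr opprK subrK.
Qed.

Lemma refl_cochar_alphav i : refl_cochar i (alphav i) = - alphav i.
Proof.
by rewrite /refl_cochar root_coroot // scaler_nat mulr2n opprD addrA subrr sub0r.
Qed.

Lemma refl_cochar_stable i y : Y y -> Y (refl_cochar i y).
Proof.
move=> Yy; apply: cochar_subgroup.2 => //; apply: subgroupZ.
- exact: cochar_subgroup.
- exact: pairing_cochar_int.
- exact: coroot_cochar.
Qed.

Lemma refl_root_perm i : exists2 t : I -> I,
  injective t & forall j, alpha (t j) = refl_char i (alpha j).
Proof.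
have /choice[t tE] := refl_char_root hD i; exists t => // j k tjk.
apply: (root_inj hD); apply: pairing_nondegenerate => y.
by rewrite -(refl_cocharK i y) -!pairing_refl -!tE tjk.
Qed.

(** The form in which semisimplicity is used. *)
Lemma roots_separate x y :
  (forall i, pairing (alpha i) x = pairing (alpha i) y) -> x = y.
Proof.
move=> xy; apply: pairing_nondegenerate => z.
have /span_coef[c ->] : z \in <<codom alpha>>%VS by rewrite hss memvf.
rewrite !pairing_sumr; apply: eq_bigr => i _.
by rewrite !pairingZr !(pairingC _ (alpha i)) xy.
Qed.

(** Invariant because reflections permute the roots, and definite because the
roots span. *)
Definition inv_form x y : rat :=
  \sum_i pairing (alpha i) x * pairing (alpha i) y.

Lemma inv_formC x y : inv_form x y = inv_form y x.
Proof. by apply: eq_bigr => i _; rewrite mulrC. Qed.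

Lemma inv_formBr x y z : inv_form x (y - z) = inv_form x y - inv_form x z.
Proof.
by rewrite /inv_form -sumrB; apply: eq_bigr => i _; rewrite pairingBr mulrBr.
Qed.

Lemma inv_formZr a x y : inv_form x (a *: y) = a * inv_form x y.
Proof.
by rewrite /inv_form mulr_sumr; apply: eq_bigr => i _; rewrite pairingZr mulrCA.
Qed.

Lemma inv_form_refl i x y :
  inv_form (refl_cochar i x) (refl_cochar i y) = inv_form x y.
Proof.
have [t tinj tE] := refl_root_perm i.
rewrite [RHS](reindex_inj tinj); apply: eq_bigr => j _.
by rewrite tE !pairing_refl.
Qed.

Lemma inv_form_eq0 x : inv_form x x = 0 -> x = 0.
Proof.
move=> /eqP; rewrite psumr_eq0 => [/allP x0|i _]; last exact: sqr_ge0.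
apply: roots_separate => i; rewrite pairing0r.
by have := x0 i (mem_index_enum _); rewrite mulf_eq0 orbb => /eqP.
Qed.

Lemma inv_form_nondegenerate x : (forall y, inv_form y x = 0) -> x = 0.
Proof. by move=> x0; apply: inv_form_eq0. Qed.

(** The invariant form identifies each root with a multiple of its coroot, as
in Euclidean root systems: this is invariance under the reflection, which
negates the coroot. *)
Lemma inv_form_alphav i : exists2 a : rat, a != 0 &
  forall y, inv_form y (alphav i) = a * pairing (alpha i) y.
Proof.
exists (inv_form (alphav i) (alphav i) / 2).
  rewrite mulf_neq0 ?invr_eq0 ?pnatr_eq0 //; apply/eqP => /inv_form_eq0 a0.
  by have := root_coroot hD i; rewrite a0 pairing0r => /eqP; rewrite eq_sym pnatr_eq0.
move=> y; have := inv_form_refl i y (alphav i).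
rewrite refl_cochar_alphav -scaleN1r inv_formZr mulN1r inv_formC inv_formBr.
rewrite inv_formZr [inv_form _ y]inv_formC.
set a := inv_form (alphav i) _; set p := pairing _ _; set b := inv_form y _ => h.
have : b * 2 = p * a by rewrite mulr_natr mulr2n -[X in X + _]h opprB subrK.
move=> b2; apply: (@mulIf _ 2) => //; rewrite b2.
by rewrite mulrAC divfK // mulrC.
Qed.

(** A coroot is determined by its root: up to a factor it is the dual of the
root for the invariant form, and the factor is fixed by their pairing. *)
Lemma coroot_unique i x a : a != 0 ->
  (forall y, inv_form y x = a * pairing (alpha i) y) ->
  pairing (alpha i) x = 2 -> x = alphav i.
Proof.
move=> a0 xE ax; have [b b0 bE] := inv_form_alphav i.
have ab : a^-1 *: x = b^-1 *: alphav i.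
  apply/eqP; rewrite -subr_eq0; apply/eqP; apply: inv_form_nondegenerate => y.
  by rewrite inv_formBr !inv_formZr xE bE !mulKf // subrr.
have := congr1 (pairing (alpha i)) ab.
rewrite !pairingZr ax root_coroot // => /mulIf/invr_inj eqab.
move: ab; rewrite eqab ?pnatr_eq0 // => /(congr1 (fun z => b *: z)).
by rewrite !scalerA divff // !scale1r.
Qed.

Lemma coroot_refl i j k :
  alpha k = refl_char i (alpha j) -> alphav k = refl_cochar i (alphav j).
Proof.
move=> kE; have [a a0 aE] := inv_form_alphav j.
apply/esym; apply: (coroot_unique a0) => [y|].
  by rewrite kE pairing_refl -aE -{1}(refl_cocharK i y) inv_form_refl.
by rewrite kE pairing_refl refl_cocharK root_coroot.
Qed.

Lemma coroot_opp j k : alpha k = - alpha j -> alphav k = - alphav j.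
Proof.
move=> kE; rewrite -refl_cochar_alphav; apply: coroot_refl.
by rewrite kE /refl_char root_coroot // scaler_nat mulr2n opprD addrA subrr sub0r.
Qed.

Lemma pairing_eq0_sym i j :
  pairing (alpha i) (alphav j) = 0 -> pairing (alpha j) (alphav i) = 0.
Proof.
have [a a0 aE] := inv_form_alphav i; have [b b0 bE] := inv_form_alphav j.
move=> ij0; have /eqP := bE (alphav i).
by rewrite inv_formC aE ij0 mulr0 eq_sym mulf_eq0 (negbTE b0) => /eqP.
Qed.

(** Dually to semisimplicity, the coroots span: the invariant form carries
them to multiples of the roots. *)
Lemma coroots_span : <<codom alphav>>%VS = fullv.
Proof.
apply/vspaceP => x; rewrite memvf.
have /choice[a aP] : forall i, exists a : rat, a != 0 /\
    forall y, inv_form y (alphav i) = a * pairing (alpha i) y.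
  by move=> i; have [a ? ?] := inv_form_alphav i; exists a.
have [c cE] : exists c : I -> rat,
    \sum_i pairing (alpha i) x *: alpha i = \sum_i c i *: alpha i.
  by apply: span_coef; rewrite hss memvf.
suff -> : x = \sum_i (c i / a i) *: alphav i.
  by apply: memv_suml => i _; rewrite memvZ // memv_span // codom_f.
apply/eqP; rewrite -subr_eq0; apply/eqP; apply: inv_form_nondegenerate => y.
rewrite inv_formBr; apply/eqP; rewrite subr_eq0; apply/eqP.
have -> : inv_form y x = pairing (\sum_i c i *: alpha i) y.
  rewrite -cE pairing_suml inv_formC.
  by apply: eq_bigr => i _; rewrite pairingZl.
rewrite pairing_suml /inv_form.
under [RHS]eq_bigr do rewrite pairing_sumr mulr_sumr.
rewrite exchange_big; apply: eq_bigr => i _.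
under eq_bigr do rewrite pairingZr mulrCA.
rewrite -mulr_sumr -/(inv_form y (alphav i)) (aP i).2 pairingZl mulrA divfK //.
exact: (aP i).1.
Qed.

End RootSystem.

(** * Weights modulo characters: finiteness *)

Section Exponent.
Set Implicit Arguments.
Unset Strict Implicit.
Local Open Scope ring_scope.
Local Open Scope classical_set_scope.
Variables (r : nat) (D : rootDatum r).
Hypotheses (hD : is_root_datum D) (hss : semisimple D).
Local Notation V := 'rV[rat]_r.
Local Notation Y := (cocharLat D).
Local Notation alpha := (@Defs.root r D).

(** Vectors with integral pairings against the roots are cocharacters up to a
bounded denominator, because each of the finitely many basis characters has a
multiple in the root lattice. *)
Lemma coweight_exponent : exists2 N : nat, (0 < N)%N &
  forall v : V, (forall i, pairing (alpha i) v \is a Num.int) -> Y (N%:R *: v).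
Proof.
have [E _ XE] := charLat_lattice hD.
have /choice[k kE] : forall j, exists k : nat,
    (0 < k)%N /\ zspan alpha (k%:R *: row j E).
  by move=> j; have [k ? ?] := zspan_multiple (row j E) hss; exists k.
exists (\prod_j k j)%N; first by rewrite prodn_gt0 // => j; case: (kE j).
move=> v av; rewrite (cocharLat_dual hD) => x; rewrite XE => -[c ->].
rewrite pairing_suml rpred_sum // => j _.
rewrite -scaler_int pairingZl rpredM ?intr_int // pairingZr (bigD1 j) //=.
rewrite natrM mulrAC rpredM ?rpred_nat // -pairingZl.
have [b ->] := (kE j).2; rewrite pairing_suml rpred_sum // => i _.
by rewrite -scaler_int pairingZl rpredM ?intr_int.
Qed.

(** A vector [v] of [A] is known modulo [B] from the residues modulo [n * N] of
the pairings of [N v] with a basis of the characters. *)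
Lemma finite_cosets (A B : set V) (n : nat) : (0 < n)%N -> subgroup B ->
  (forall v, A v -> forall i, pairing (alpha i) v \is a Num.int) ->
  (forall y, Y y -> B (n%:R *: y)) -> finite_set (cosets A B).
Proof.
move=> n0 sB Aint nYB; have [N N0 NP] := coweight_exponent.
have [E _ XE] := charLat_lattice hD.
have M0 : (0 < n * N)%N by rewrite muln_gt0 n0.
pose M : int := (n * N)%:Z.
have M_neq0 : M != 0 by rewrite -lt0n.
pose c v j : int := Num.floor (pairing (row j E) (N%:R *: v)).
have cE v j : A v -> pairing (row j E) (N%:R *: v) = (c v j)%:~R.
  move=> Av; rewrite /c floorK //; have := NP v (Aint _ Av).
  rewrite (cocharLat_dual hD); apply; rewrite XE.
  exists (fun k => (k == j)%:R); rewrite (bigD1 j) //= eqxx mulr1z.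
  by rewrite big1 ?addr0 // => k /negbTE ->; rewrite mulr0z.
pose f v : {ffun 'I_r -> 'I_(n * N).-1.+1} := [ffun j => inord `|(c v j %% M)%Z|].
apply: (@card_le_finite _ _ _ [set: {ffun 'I_r -> 'I_(n * N).-1.+1}]); last first.
  exact: finite_finset.
apply: (cosets_inj (f := f)) => // v w Av Aw fvw.
have -> : v - w = n%:R *: (n%:R^-1 *: (v - w)).
  by rewrite scalerA divff ?scale1r // pnatr_eq0 -lt0n.
apply: nYB; rewrite (cocharLat_dual hD) => x; rewrite XE => -[b ->].
rewrite pairing_suml rpred_sum // => j _.
rewrite -scaler_int pairingZl rpredM ?intr_int // pairingZr.
have : (M %| c v j - c w j)%Z.
  rewrite -eqz_mod_dvd; apply/eqP.
  have := congr1 (fun h : {ffun _ -> _} => val (h j)) fvw; rewrite /= !ffunE.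
  have lt u : (`|(c u j %% M)%Z| < (n * N).-1.+1)%N.
    by rewrite prednK // -ltz_nat gez0_abs ?modz_ge0 // ltz_pmod.
  rewrite !inordK // => /(congr1 Posz).
  by rewrite !gez0_abs ?modz_ge0.
case/dvdzP => q /(congr1 (intr : int -> rat)); rewrite intrM intrB -!cE //.
rewrite -pairingBr -scalerBr pairingZr /M PoszM intrM -!pmulrn => h.
have -> : pairing (row j E) (v - w) = n%:R * q%:~R.
  apply: (@mulfI _ N%:R); first by rewrite pnatr_eq0 -lt0n.
  by rewrite h; ring.
by rewrite mulKf ?intr_int // pnatr_eq0 -lt0n.
Qed.

End Exponent.

(** * The pairing of a root with rho *)

Section Rho.
Set Implicit Arguments.
Unset Strict Implicit.
Local Open Scope ring_scope.
Variables (r : nat) (D : rootDatum r) (Delta : {set rootIdx D}).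
Hypotheses (hD : is_root_datum D) (hss : semisimple D) (hDelta : is_base Delta).
Local Notation alpha := (@Defs.root r D).
Local Notation alphav := (@coroot r D).

Lemma free_image_coef (J : finType) (f : J -> 'rV[rat]_r) (A : {set J})
    (c : J -> rat) k :
  free [seq f j | j in A] -> \sum_(j in A) c j *: f j = 0 -> k \in A -> c k = 0.
Proof.
move=> fA s0 kA; pose X := in_tuple [seq f j | j in A].
have szX : size X = #|A| by rewrite size_image.
have idx j : j \in A -> (index j (enum A) < size X)%N.
  by move=> jA; rewrite szX cardE index_mem mem_enum.
have nthX j : j \in A -> X`_(index j (enum A)) = f j.
  move=> jA; rewrite (nth_map k) ?nth_index ?mem_enum //.
  by rewrite index_mem mem_enum.
have := congr1 (coord X (Ordinal (idx k kA))) s0.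
rewrite linear0 linear_sum (bigD1 k) //= linearZ /= -{1}(nthX k) //.
have cX j (jA : j \in A) : coord X (Ordinal (idx k kA)) (f j) = (j == k)%:R.
  rewrite -(nthX j jA) -[index j _]/(val (Ordinal (idx j jA))) coord_free //.
  congr (nat_of_bool _)%:R; apply/eqP/eqP => [/(congr1 val)/=|jk].
    by move/(congr1 (nth k (enum A))); rewrite !nth_index ?mem_enum.
  by apply: val_inj; rewrite /= jk.
rewrite nthX // cX // eqxx mulr1 big1 ?addr0 // => j /andP[jA jk].
by rewrite linearZ /= cX // (negbTE jk) mulr0.
Qed.

Lemma root_neq0 i : alpha i != 0.
Proof.
apply/eqP => a0; have := root_coroot hD i.
by rewrite a0 pairingC pairing0r => /eqP; rewrite eq_sym pnatr_eq0.
Qed.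

Lemma positive_opp i j : alpha j = - alpha i ->
  `[< positive Delta j >] = ~~ `[< positive Delta i >].
Proof.
move=> ji; apply/asboolP/negP => [[d dE] /asboolP[c cE]|].
  have cd : \sum_(k in Delta) ((c k + d k)%:R : rat) *: alpha k = 0.
    under eq_bigr do rewrite natrD scalerDl !scaler_nat.
    by rewrite big_split /= -cE -dE ji subrr.
  have /eqP := root_neq0 i; apply; rewrite cE big1 // => k kD.
  have /eqP := free_image_coef hDelta.1 cd kD.
  by rewrite pnatr_eq0 addn_eq0 => /andP[/eqP-> _].
have [pi []|[k kp ik] _] := hDelta.2 i; first exact/asboolP.
by suff -> : j = k by []; apply: (root_inj hD); rewrite ji ik opprK.
Qed.

(** The orbits of the involution have two elements, on which [f] is constant. *)
Lemma sum_involution_even (J : finType) (s : J -> J) (f : J -> rat) (A : {set J}) :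
  (forall j, j \in A -> s j \in A) -> (forall j, s (s j) = j) ->
  (forall j, j \in A -> s j != j) -> (forall j, f (s j) = f j) ->
  (forall j, f j \is a Num.int) -> (\sum_(j in A) f j) / 2 \is a Num.int.
Proof.
move=> sA ss sfix fs fint; have [m] := ubnP #|A|.
elim: m A sA sfix => // m IH A sA sfix Am.
have [->|[a aA]] := set_0Vmem A; first by rewrite big_set0 mul0r rpred0.
rewrite (big_setD1 a) //= (big_setD1 (s a)) /=; last first.
  by rewrite !inE sfix // sA.
rewrite fs addrA; set S := \sum_(_ in _) _.
have -> : (f a + f a + S) / 2 = f a + S / 2 by field.
rewrite rpredD // /S.
apply: IH => [j|j|].
- rewrite !inE => /and3P[jsa ja jA]; rewrite sA // andbT.
  by rewrite (inj_eq (can_inj ss)) ja /=; apply: contraNneq jsa => <-; rewrite ss.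
- by rewrite !inE => /and3P[_ _]; apply: sfix.
rewrite -ltnS; apply: leq_trans Am; rewrite ltnS (cardsD1 a A) aA ltnS.
by apply: subset_leq_card; apply: subD1set.
Qed.

(** Pairing with [rho] is computed modulo the even contributions. The
reflection in [i] changes the sign of the pairing, so the positive roots which
it keeps positive cancel; the others come in pairs under minus the reflection,
except for the positive one among [i] and its opposite, which contributes 2 or
-2 to twice the pairing. Since [d] divides the pairing of [i] with its coroot,
which is 2, the sign does not matter modulo [d]. *)
Lemma rho_pairing i (d : rat) : d != 0 ->
  (forall j, pairing (alpha i) (alphav j) / d \is a Num.int) ->
  (pairing (alpha i) (rho Delta) - 1) / d \is a Num.int.
Proof.
move=> d0 dP; pose g j := pairing (alpha i) (alphav j).
have [t tinj tE] := refl_root_perm hD i.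
have /choice[o oE] : forall j, exists k, alpha k = - alpha j.
  move=> j; have [k kE] := refl_char_root hD j j; exists k.
  by rewrite kE /refl_char root_coroot // scaler_nat mulr2n opprD addrA subrr sub0r.
have cE := coroot_refl hD hss; have oc := coroot_opp hD hss.
have go j : g (o j) = - g j by rewrite /g (oc _ _ (oE j)) pairingNr.
have gi : g i = 2 by rewrite /g root_coroot.
have ti : t i = o i.
  apply: (root_inj hD); rewrite tE oE /refl_char root_coroot //.
  by rewrite scaler_nat mulr2n opprD addrA subrr sub0r.
have gt j : g (t j) = - g j.
  by rewrite /g (cE _ _ _ (tE j)) -pairing_refl -tE ti oE pairingNl.
have tt j : t (t j) = j.
  apply: (root_inj hD); rewrite !tE; apply: pairing_nondegenerate => z.
  by rewrite !pairing_refl refl_cocharK.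
have ot j : o (t j) = t (o j).
  apply: (root_inj hD); rewrite oE !tE oE; apply: pairing_nondegenerate => z.
  by rewrite pairingNl !pairing_refl pairingNl.
have oo j : o (o j) = j by apply: (root_inj hD); rewrite !oE opprK.
pose pos j := `[< positive Delta j >].
have poso j : pos (o j) = ~~ pos j by apply: positive_opp; apply: oE.
(* Minus the reflection; [b] is its only fixed point among the positive roots. *)
pose s j := o (t j).
have ss j : s (s j) = j by rewrite /s ot oo tt.
pose b := if pos i then i else o i.
have sb : s b = b by rewrite /b /s; case: ifP => _; rewrite -?ot ti !oo.
have posb : pos b by rewrite /b; case: ifPn => //; rewrite poso.
have gb : g b = 2 \/ g b = -2.
  by rewrite /b; case: ifP => _; [left|right]; rewrite ?go gi.
(* The positive roots made negative by the reflection. *)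
pose A := [set j | pos j && ~~ pos (t j)].
have sfix j : pos j -> s j = j -> j = b.
  move=> pj sj; have jE : alpha j = (pairing (alpha j) (alphav i) / 2) *: alpha i.
    apply: (@scalerI _ _ 2); rewrite // scalerA mulrCA divff // mulr1.
    have := oE (t j); rewrite -/(s j) sj tE /refl_char opprB => jE.
    by rewrite scaler_nat mulr2n [X in X + _]jE subrK.
  have [c1|c1] := root_reduced hD jE; rewrite c1 in jE.
    have ji : j = i by apply: (root_inj hD); rewrite jE scale1r.
    by rewrite /b -ji pj.
  have ji : j = o i by apply: (root_inj hD); rewrite jE scaleN1r oE.
  by move: pj; rewrite /b ji poso => /negbTE ->.
have bA : b \in A by rewrite inE posb -poso -/(s b) sb posb.
have evenA : (\sum_(j in A :\ b) g j / d) / 2 \is a Num.int.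
  apply: (@sum_involution_even _ s) => // [j|j|j].
  - rewrite !inE => /and3P[jb pj tj]; rewrite -{1}sb (inj_eq (can_inj ss)) jb.
    by rewrite /s poso tj ot tt poso negbK.
  - by rewrite !inE => /and3P[jb pj _]; apply: contraNneq jb => /sfix->.
  - by rewrite /s go gt opprK.
have sumE : \sum_(j | pos j) g j = \sum_(j in A) g j.
  rewrite (bigID (fun j => pos (t j))) /=.
  rewrite [X in X + _](_ : _ = 0) ?add0r; first by apply: eq_bigl => j; rewrite inE.
  set S := LHS; suff : S = - S by move=> SS; lra.
  rewrite {1}/S (reindex_inj tinj) /= -sumrN; apply: eq_big => j; last by rewrite gt.
  by rewrite tt andbC.
rewrite /rho pairingZr pairing_sumr sumE (big_setD1 b) //=.
have -> : (2^-1 * (g b + \sum_(j in A :\ b) g j) - 1) / d =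
    (g b / 2 - 1) / d + (\sum_(j in A :\ b) g j / d) / 2.
  by rewrite -mulr_suml; field.
apply: rpredD => //; case: gb => ->; first by rewrite divff // subrr mul0r rpred0.
have -> : (-2 / 2 - 1) / d = - (2 / d) by field.
by rewrite rpredN -(root_coroot hD i).
Qed.

End Rho.

(** * Weyl-invariant quadratic forms and the lattice Y_{Q,n} *)

Section QuadraticForm.
Set Implicit Arguments.
Unset Strict Implicit.
Local Open Scope ring_scope.
Local Open Scope classical_set_scope.
Variables (r : nat) (D : rootDatum r) (Q : 'rV[rat]_r -> int).
Hypotheses (hD : is_root_datum D) (hss : semisimple D).
Hypotheses (hQ : is_quadratic_form D Q) (hW : weyl_invariant D Q).
Local Notation V := 'rV[rat]_r.
Local Notation I := (rootIdx D).
Local Notation Y := (cocharLat D).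
Local Notation L := (YQn D Q).
Local Notation alpha := (@Defs.root r D).
Local Notation alphav := (@coroot r D).
Local Notation B x y := ((polar Q x y)%:~R : rat).
Local Notation q i := ((Q (alphav i))%:~R : rat).
Implicit Types (i j k : I) (x y z : V) (n : nat).

Let sY : subgroup Y := cochar_subgroup hD.

Lemma polarC x y : polar Q x y = polar Q y x.
Proof. by rewrite /polar [x + y]addrC addrAC. Qed.

Lemma polarBl x y z : Y x -> Y y -> Y z -> B (x - y) z = B x z - B y z.
Proof.
move=> Yx Yy Yz; have Yxy := sY.2 _ _ Yx Yy.
by have := hQ.2 _ _ _ Yxy Yy Yz; rewrite subrK => ->; rewrite intrD addrK.
Qed.

Lemma polar_natl n y z : Y y -> Y z -> B (n%:R *: y) z = n%:R * B y z.
Proof.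
move=> Yy Yz; elim: n => [|n IH].
  by rewrite scale0r mul0r -(subrr y) polarBl // subrr.
have Yny : Y (n%:R *: y) by apply: subgroupZ => //; apply: rpred_nat.
by rewrite -natr1 scalerDl scale1r hQ.2 // intrD IH mulrDl mul1r.
Qed.

Lemma polar0l z : Y z -> B 0 z = 0.
Proof. by move=> Yz; rewrite -(subrr z) polarBl // subrr. Qed.

Lemma polarZl (a : rat) y z : a \is a Num.int -> Y y -> Y z ->
  B (a *: y) z = a * B y z.
Proof.
move=> /intrP[[n|n] ->] Yy Yz; first by rewrite -pmulrn polar_natl.
have -> : (Negz n)%:~R *: y = 0 - n.+1%:R *: y.
  by rewrite NegzE intrN -pmulrn scaleNr sub0r.
have Y0 := sY.1; have Yny : Y (n.+1%:R *: y).
  by apply: subgroupZ => //; apply: rpred_nat.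
by rewrite polarBl // polar0l // polar_natl // NegzE intrN -pmulrn sub0r mulNr.
Qed.

Lemma polarNl y z : Y y -> Y z -> B (- y) z = - B y z.
Proof. by move=> Yy Yz; rewrite -scaleN1r polarZl ?mulN1r // rpredN1. Qed.

Lemma polar_refl i x y : Y x -> Y y ->
  polar Q (refl_cochar i x) (refl_cochar i y) = polar Q x y.
Proof.
move=> Yx Yy; have inv z : Y z -> Q (refl_cochar i z) = Q z.
  by move=> Yz; apply: hW => //; apply: (weyl_refl i); apply: weyl_id.
have reflD : refl_cochar i x + refl_cochar i y = refl_cochar i (x + y).
  by rewrite /refl_cochar pairingDr scalerDl opprD addrACA.
by rewrite /polar reflD !inv //; apply: subgroupD.
Qed.

(** Invariance under the reflection, which negates the coroot, forces the
polar form to be proportional to the root. *)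
Lemma polar_alphav i y : Y y -> B y (alphav i) = pairing (alpha i) y * q i.
Proof.
move=> Yy; set a := pairing _ _; have Ya := coroot_cochar hD i.
have Yay : Y (a *: alphav i).
  by apply: subgroupZ => //; apply: pairing_cochar_int.
have Baa : B (alphav i) (alphav i) = 2 * q i.
  have := hQ.1 2 _ Ya; rewrite /polar -mulr2n -pmulrn => ->.
  by rewrite !intrB intrM; ring.
have : B y (alphav i) = - (B y (alphav i) - a * (2 * q i)).
  have Ysy := refl_cochar_stable hD i Yy.
  rewrite -[in LHS](polar_refl i Yy Ya) refl_cochar_alphav // polarC polarNl //.
  by rewrite polarC /refl_cochar polarBl // polarZl ?Baa // pairing_cochar_int.
by move=> e; lra.
Qed.

Lemma dvdz_ratE n (k : int) : (0 < n)%N ->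
  (n%:Z %| k)%Z = (k%:~R / n%:R \is a @Num.int rat).
Proof.
move=> n0; have n_neq0 : (n%:R : rat) != 0 by rewrite pnatr_eq0 -lt0n.
apply/idP/idP => [|/intrP[m] /(canRL (divfK n_neq0)) e].
  by move=> /dvdzP[m ->]; rewrite intrM -pmulrn mulfK // intr_int.
by apply/dvdzP; exists m; apply: (@intr_inj rat); rewrite e intrM -pmulrn.
Qed.

Lemma YQnE n y : (0 < n)%N ->
  L n y <-> Y y /\ forall z, Y z -> B y z / n%:R \is a Num.int.
Proof.
by move=> n0; split=> -[Yy yP]; split=> // z /yP; rewrite dvdz_ratE.
Qed.

Lemma YQn_subgroup n : (0 < n)%N -> subgroup (L n).
Proof.
move=> n0; split=> [|x y /(YQnE _ n0)[Yx xP] /(YQnE _ n0)[Yy yP]]; apply/YQnE => //.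
  split=> [|z Yz]; first exact: sY.1.
  by rewrite polar0l // mul0r.
split=> [|z Yz]; first exact: sY.2.
by rewrite polarBl // mulrBl rpredB ?xP ?yP.
Qed.

Lemma YQn_multiple n y : (0 < n)%N -> Y y -> L n (n%:R *: y).
Proof.
move=> n0 Yy; apply/YQnE => //; split=> [|z Yz].
  by apply: subgroupZ => //; apply: rpred_nat.
by rewrite polar_natl // mulrAC divff ?mul1r ?intr_int // pnatr_eq0 -lt0n.
Qed.

Lemma YQn_pairing n y i : (0 < n)%N -> L n y ->
  pairing (alpha i) y * q i / n%:R \is a Num.int.
Proof.
by move=> n0 /(YQnE _ n0)[Yy yP]; rewrite -polar_alphav // yP //; apply: coroot_cochar.
Qed.

(** An element of [Y] is determined modulo the radical of the form by its
pairings with the roots on whose coroots [Q] does not vanish, because the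
coroots have finite index in [Y]. *)
Lemma polar_scale x y (a : rat) : Y x -> Y y ->
  (forall i, pairing (alpha i) x * q i = a * (pairing (alpha i) y * q i)) ->
  forall z, Y z -> B x z = a * B y z.
Proof.
move=> Yx Yy xy; pose S z := Y z /\ B x z = a * B y z.
have sS : subgroup S.
  split=> [|u v [Yu uE] [Yv vE]].
    split; first exact: sY.1.
    by rewrite ![polar Q _ 0]polarC !polar0l ?mulr0.
  by split; [exact: sY.2|rewrite ![polar Q _ (u - v)]polarC !polarBl // ![polar Q _ x]polarC ![polar Q _ y]polarC uE vE mulrBr].
move=> z Yz; have [k k0] := zspan_multiple z (coroots_span hD hss).
have Sa i : S (alphav i).
  by split; [exact: coroot_cochar|rewrite !polar_alphav].
move=> /(subgroup_zspan sS Sa)[_]; rewrite ![polar Q _ (_ *: _)]polarC.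
rewrite !polar_natl // mulrCA ![polar Q z _]polarC => /mulfI; apply.
by rewrite pnatr_eq0 -lt0n.
Qed.

(** The pairings with all of [Y] are kept: when they are all even, the condition
can be weaker than the divisibility of [a] by [n_root n i]. *)
Lemma YQn_coroot n i (a : rat) : (0 < n)%N -> a \is a Num.int ->
  L n (a *: alphav i) <->
  forall y, Y y -> a * q i * pairing (alpha i) y / n%:R \is a Num.int.
Proof.
move=> n0 aint; have Ya := coroot_cochar hD i.
have Yaa : Y (a *: alphav i) by apply: subgroupZ.
have BE y : Y y -> B (a *: alphav i) y = a * q i * pairing (alpha i) y.
  move=> Yy; rewrite (@polar_scale _ (alphav i) a) //.
    by rewrite polarC polar_alphav //; ring.
  by move=> j; rewrite pairingZr mulrA.
split=> [/(YQnE _ n0)[_ aP] y Yy|aP]; first by rewrite -BE // aP.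
by apply/YQnE => //; split=> // y Yy; rewrite BE // aP.
Qed.

Lemma n_root_gt0 n i : (0 < n)%N -> (0 < n_root Q n i)%N.
Proof.
move=> n0; rewrite /n_root divn_gt0 ?gcdn_gt0 ?n0 //.
by rewrite dvdn_leq // dvdn_gcdl.
Qed.

(** The common factor of [n] and [q i] cancels. *)
Lemma n_root_int n i (a : rat) : (0 < n)%N -> a \is a Num.int ->
  (a / (n_root Q n i)%:R \is a Num.int) = (a * q i / n%:R \is a Num.int).
Proof.
move=> n0 /intrP[k ->]; rewrite -intrM -!dvdz_ratE ?n_root_gt0 //.
rewrite !dvdzE abszM /=.
set g := gcdn n `|Q (alphav i)|; have g0 : (0 < g)%N by rewrite gcdn_gt0 n0.
have nE : n = (n_root Q n i * g)%N by rewrite divnK ?dvdn_gcdl.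
have qE : `|Q (alphav i)|%N = (`|Q (alphav i)| %/ g * g)%N by rewrite divnK ?dvdn_gcdr.
rewrite [in RHS]qE [X in _ = (X %| _)%N]nE mulnA dvdn_pmul2r // Gauss_dvdl //.
rewrite /coprime -(eqn_pmul2r g0) muln_gcdl -qE -nE mul1n.
exact/eqP.
Qed.

Lemma YQn_refl n i y : (0 < n)%N -> L n y -> L n (refl_cochar i y).
Proof.
move=> n0 Ly; apply: (YQn_subgroup n0).2 => //; apply/YQn_coroot => //.
  by apply: pairing_cochar_int => //; case: Ly.
move=> z Yz; rewrite mulrAC rpredM ?pairing_cochar_int //.
exact: YQn_pairing.
Qed.

End QuadraticForm.

(** * Fixed points of the twisted action *)

Section FixedPoints.
Set Implicit Arguments.
Unset Strict Implicit.
Local Open Scope ring_scope.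
Local Open Scope classical_set_scope.
Variables (r : nat) (D : rootDatum r) (Delta : {set rootIdx D}).
Variable Q : 'rV[rat]_r -> int.
Hypotheses (hD : is_root_datum D) (hDelta : is_base Delta) (hss : semisimple D).
Hypotheses (hQ : is_quadratic_form D Q) (hW : weyl_invariant D Q).
Local Notation V := 'rV[rat]_r.
Local Notation I := (rootIdx D).
Local Notation Y := (cocharLat D).
Local Notation L := (YQn D Q).
Local Notation alpha := (@Defs.root r D).
Local Notation alphav := (@coroot r D).
Local Notation q i := ((Q (alphav i))%:~R : rat).
Local Notation rho := (rho Delta).
Local Notation P n := (weight_lattice (dual_datum D Q n)).
Implicit Types (i j k : I) (x y z v : V) (n : nat).

Let sY : subgroup Y := cochar_subgroup hD.

Lemma pairing_rho_int i : pairing (alpha i) rho \is a Num.int.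
Proof.
have := rho_pairing hD hss hDelta (i := i) (oner_neq0 _).
rewrite divr1 => rhoP; rewrite -[pairing _ _](subrK 1) rpredD ?rpred1 // rhoP //.
by move=> j; rewrite divr1; apply: pairing_coroot_int.
Qed.

(** The equations come from the reflections only; these generate the Weyl group,
so they characterise the fixed points ([XQn_fixedE]). *)
Definition fixed_reps n : set V :=
  [set y | Y y /\ forall i, L n (pairing (alpha i) (y - rho) *: alphav i)].

Lemma twisted_refl i y : twisted Delta (refl_cochar i) y =
  y - pairing (alpha i) (y - rho) *: alphav i.
Proof. by rewrite /twisted /refl_cochar addrAC subrK. Qed.

Lemma XQn_fixedE n : (0 < n)%N ->
  XQn_fixed Q Delta n = cosets (fixed_reps n) (L n).
Proof.
move=> n0; have sL := YQn_subgroup hD hQ n0.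
apply/seteqP; split=> C.
  case=> -[y Yy yC] Cfix; exists y => //; split=> // i.
  have := Cfix _ (weyl_refl i (weyl_id D)); rewrite -yC => /seteqP[sub _].
  have [b Lb] : [set y + b | b in L n] (twisted Delta (refl_cochar i) y).
    by apply: sub; exists y => //; exists 0; [exact: sL.1|rewrite addr0].
  rewrite twisted_refl => /addrI bE.
  by rewrite -[_ *: _]opprK -bE; apply: subgroupN.
case=> y [Yy yfix] yC; split; first by exists y.
have stable i x : C x -> C (twisted Delta (refl_cochar i) x).
  rewrite -yC => -[b Lb <-].
  exists (refl_cochar i b - pairing (alpha i) (y - rho) *: alphav i).
    by apply: sL.2 => //; apply: YQn_refl.
  rewrite twisted_refl /refl_cochar [y + b - rho]addrAC.
  rewrite [pairing _ (_ + b)]pairingDr scalerDl.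
  by rewrite opprD -!addrA; congr (_ + (_ + _)); rewrite addrC.
have invol i x : twisted Delta (refl_cochar i) (twisted Delta (refl_cochar i) x) = x.
  by rewrite /twisted addrK refl_cocharK // subrK.
move=> w; elim=> [|i {}w _ IH].
  apply/seteqP; split=> [_ [x Cx <-]|x Cx]; first by rewrite /twisted subrK.
  by exists x => //; rewrite /twisted subrK.
have -> : twisted Delta (fun x => refl_cochar i (w x)) =
    twisted Delta (refl_cochar i) \o twisted Delta w.
  by apply/funext => x; rewrite /twisted /= addrK.
rewrite -image_comp IH; apply/seteqP; split=> [_ [x Cx <-]|x Cx].
  exact: stable.
by exists (twisted Delta (refl_cochar i) x) => //; apply: stable.
Qed.

Lemma parity_cases (a : rat) : a \is a Num.int ->
  a / 2 \is a Num.int \/ (a - 1) / 2 \is a Num.int.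
Proof.
move=> /intrP[m ->]; rewrite (divz_eq m 2).
have : (0 <= m %% 2)%Z && ((m %% 2)%Z < 2) by rewrite modz_ge0 // ltz_pmod.
case: (m %% 2)%Z => // -[|[|]] // _; [left|right].
  by rewrite addr0 intrM mulfK // intr_int.
by rewrite intrD intrM addrK mulfK // intr_int.
Qed.

(** When [alpha i] takes an odd value on [Y], the coroot can be cancelled from
the equation of each of the two fixed points. Otherwise [alpha i] is divisible
by 2 and each equation only holds up to a factor 2; but then both pairings are
odd, as [pairing (alpha i) rho] is, and their difference is even. *)
Lemma fixed_reps_sub n x y : (0 < n)%N -> fixed_reps n x -> fixed_reps n y ->
  forall i, pairing (alpha i) (x - y) * q i / n%:R \is a Num.int.
Proof.
move=> n0 [Yx xfix] [Yy yfix] i.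
have n_neq0 : (n%:R : rat) != 0 by rewrite pnatr_eq0 -lt0n.
pose p z := pairing (alpha i) (z - rho).
have p_int z : Y z -> p z \is a Num.int.
  by move=> Yz; rewrite /p pairingBr rpredB ?pairing_rho_int ?pairing_cochar_int.
have eqn z w : Y z -> L n (p z *: alphav i) -> Y w ->
    p z * q i * pairing (alpha i) w / n%:R \is a Num.int.
  by move=> Yz /(YQn_coroot hD hss hQ hW _ n0 (p_int z Yz)); apply.
have eqn2 z : Y z -> L n (p z *: alphav i) ->
    p z * q i * 2 / n%:R \is a Num.int.
  move=> Yz Lz; rewrite -(root_coroot hD i).
  by apply: eqn => //; apply: coroot_cochar.
have Lx : L n (p x *: alphav i) := xfix i.
have Ly : L n (p y *: alphav i) := yfix i.
have -> : pairing (alpha i) (x - y) = p x - p y by rewrite /p -pairingBr opprB addrA subrK.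
(* If [alpha i] is odd at [w], then 1 is a combination of its values at [w] and at
   the coroot, where it is 2. *)
have [[w Yw w1]|even] := pselect (exists2 w, Y w &
    (pairing (alpha i) w - 1) / 2 \is a Num.int).
  have odd_eqn z : Y z -> L n (p z *: alphav i) -> p z * q i / n%:R \is a Num.int.
    move=> Yz Lz; have -> : p z * q i / n%:R =
        p z * q i * pairing (alpha i) w / n%:R
          - (p z * q i * 2 / n%:R) * ((pairing (alpha i) w - 1) / 2) by field.
    by apply: rpredB; [exact: eqn|apply: rpredM => //; exact: eqn2].
  by rewrite !mulrBl; apply: rpredB; apply: odd_eqn.
have {}even z : Y z -> pairing (alpha i) z / 2 \is a Num.int.
  move=> Yz; have [//|z1] := parity_cases (pairing_cochar_int hD i Yz).
  by case: even; exists z.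
have rho1 : (pairing (alpha i) rho - 1) / 2 \is a Num.int.
  apply: rho_pairing => // j; apply: even; exact: coroot_cochar.
have px1 : (p x + 1) / 2 \is a Num.int.
  have -> : (p x + 1) / 2 = pairing (alpha i) x / 2 - (pairing (alpha i) rho - 1) / 2.
    by rewrite /p pairingBr; field.
  by rewrite rpredB ?even.
have pxy : (p x - p y) / 2 \is a Num.int.
  by rewrite /p !pairingBr opprB addrA subrK mulrBl rpredB ?even.
have -> : (p x - p y) * q i / n%:R =
    (p x + 1) / 2 * (p x * q i * 2 / n%:R - p y * q i * 2 / n%:R)
      - (p x - p y) / 2 * (p x * q i * 2 / n%:R) by field.
by apply: rpredB; apply: rpredM => //; [apply: rpredB|]; apply: eqn2.
Qed.

Lemma dual_weightP n v : (0 < n)%N ->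
  P n v <-> forall i, pairing (alpha i) v / (n_root Q n i)%:R \is a Num.int.
Proof.
by move=> n0; split=> vP i; have := vP i; rewrite pairingZr pairingC mulrC.
Qed.

Lemma dual_weight_int n v i : (0 < n)%N -> P n v ->
  pairing (alpha i) v \is a Num.int.
Proof.
move=> n0 /dual_weightP-/(_ n0 i) vP.
have d0 : (n_root Q n i)%:R != 0 :> rat by rewrite pnatr_eq0 -lt0n n_root_gt0.
by rewrite -[pairing _ _](divfK d0) rpredM ?rpred_nat.
Qed.

Lemma finite_weight_cosets n : (0 < n)%N -> finite_set (cosets (P n) (L n)).
Proof.
move=> n0; apply: (finite_cosets hD hss n0); first exact: YQn_subgroup.
  by move=> v Pv i; apply: dual_weight_int Pv.
by move=> y; apply: YQn_multiple.
Qed.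

Lemma finite_fixed_cosets n : (0 < n)%N ->
  finite_set (cosets (fixed_reps n) (L n)).
Proof.
move=> n0; apply: (finite_cosets hD hss n0); first exact: YQn_subgroup.
  by move=> v [Yv _] i; apply: pairing_cochar_int.
by move=> y; apply: YQn_multiple.
Qed.

Lemma fixed_reps_sub_weight n x y : (0 < n)%N ->
  fixed_reps n x -> fixed_reps n y -> P n (x - y).
Proof.
move=> n0 Fx Fy; apply/dual_weightP => // i.
rewrite n_root_int //; first exact: fixed_reps_sub.
by rewrite pairingBr rpredB // pairing_cochar_int //; case: Fx Fy => ? _ [].
Qed.

Lemma bW_le_pi1 n : (0 < n)%N -> (bW Q Delta n <= pi1_order (dual_datum D Q n))%N.
Proof.
move=> n0; rewrite /bW XQn_fixedE //; have sL := YQn_subgroup hD hQ n0.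
have [[y0 Fy0]|F0] := pselect (exists y0, fixed_reps n y0); last first.
  rewrite (_ : cosets _ _ = set0) ?/Defs.card ?fset_set0 //.
  by apply/seteqP; split=> // C [y Fy _]; case: F0; exists y.
apply: (leq_card_cosets (f := fun y => y - y0)) => //.
- exact: finite_weight_cosets.
- by move=> y Fy; apply: fixed_reps_sub_weight.
by move=> x y _ _; rewrite opprB addrA subrK.
Qed.

Lemma bW_simply_connected n : simply_connected D -> (0 < n)%N ->
  (bW Q Delta n <= 1)%N.
Proof.
move=> sc n0; rewrite /bW XQn_fixedE //; have sL := YQn_subgroup hD hQ n0.
rewrite (_ : 1%N = Defs.card [set (set0 : set V)]); last first.
  by rewrite /Defs.card fset_set1 cardfs1.
apply: leq_card_set; first exact: finite_set1.
apply: (cosets_inj (f := fun=> set0)) => // x y Fx Fy _.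
have [[Yx _] [Yy _]] := (Fx, Fy).
have Yxy : Y (x - y) by apply: sY.2.
apply/YQnE => //; split=> // z; rewrite {1}sc => zspan_z.
pose S z := Y z /\ (polar Q z (x - y))%:~R / n%:R \is a @Num.int rat.
suff /(_ _ zspan_z)[_] : zspan alphav `<=` S by rewrite polarC.
apply: subgroup_zspan => [|i].
  split=> [|u v [Yu uP] [Yv vP]].
    by split; [exact: sY.1|rewrite (polar0l hD hQ) ?mul0r ?rpred0].
  by split; [exact: sY.2|rewrite (polarBl hD hQ) // mulrBl rpredB].
split; first exact: coroot_cochar.
by rewrite polarC polar_alphav //; apply: fixed_reps_sub.
Qed.

(** For an adjoint group [rho] is a cocharacter, fixed by the twisted action,
and translation by it identifies the fixed points with all the weights. *)
Lemma bW_adjoint n : adjoint_type D -> (0 < n)%N ->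
  bW Q Delta n = pi1_order (dual_datum D Q n).
Proof.
move=> ad n0; apply/eqP; rewrite eqn_leq bW_le_pi1 //= /bW XQn_fixedE //.
have sL := YQn_subgroup hD hQ n0.
have YP v : (forall i, pairing (alpha i) v \is a Num.int) -> Y v.
  move=> vP; rewrite (cocharLat_dual hD) => x; rewrite ad => -[c ->].
  rewrite pairing_suml rpred_sum // => i _.
  by rewrite -scaler_int pairingZl rpredM ?intr_int.
have Yrho : Y rho by apply: YP => i; apply: pairing_rho_int.
apply: (leq_card_cosets (f := fun v => v + rho)) => //.
- exact: finite_fixed_cosets.
- move=> v Pv; have v_int i := dual_weight_int i n0 Pv.
  split=> [|i]; first by apply: subgroupD => //; apply: YP.
  rewrite addrK; apply/YQn_coroot => // y Yy.
  rewrite mulrAC rpredM ?pairing_cochar_int // -n_root_int //.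
  by case: (@dual_weightP n v n0) => [+ _]; apply.
by move=> x y _ _; rewrite opprD addrACA subrr addr0.
Qed.

End FixedPoints.

(** * Periodicity in n *)

Section Periodicity.
Set Implicit Arguments.
Unset Strict Implicit.
Local Open Scope ring_scope.
Local Open Scope classical_set_scope.
Variables (r : nat) (D : rootDatum r) (Delta : {set rootIdx D}).
Variable Q : 'rV[rat]_r -> int.
Hypotheses (hD : is_root_datum D) (hDelta : is_base Delta) (hss : semisimple D).
Hypotheses (hQ : is_quadratic_form D Q) (hW : weyl_invariant D Q).
Local Notation V := 'rV[rat]_r.
Local Notation I := (rootIdx D).
Local Notation Y := (cocharLat D).
Local Notation L := (YQn D Q).
Local Notation alpha := (@Defs.root r D).
Local Notation alphav := (@coroot r D).
Local Notation q i := ((Q (alphav i))%:~R : rat).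
Local Notation rho := (rho Delta).
Implicit Types (i j k : I) (x y z v : V) (n m : nat) (t : rat).

Let sY : subgroup Y := cochar_subgroup hD.

(** Symmetry of the polar form at the two coroots. *)
Lemma radical_orthogonal i j : Q (alphav i) = 0 -> Q (alphav j) != 0 ->
  pairing (alpha i) (alphav j) = 0.
Proof.
move=> qi qj; apply: pairing_eq0_sym => //.
have Yi := coroot_cochar hD i; have Yj := coroot_cochar hD j.
have := polar_alphav hD hQ hW j Yi.
rewrite polarC polar_alphav // qi mulr0 => /esym/eqP.
by rewrite mulf_eq0 intr_eq0 (negbTE qj) orbF => /eqP.
Qed.

Definition scale_factor t i : rat := if Q (alphav i) == 0 then 1 else t.

(** [V] is the orthogonal sum of the span of the coroots on which [Q] vanishes
and of the span of the others; the map is the identity on the former and the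
multiplication by [t] on the latter. *)
Lemma scaling_exists : exists F : rat -> 'M[rat]_r, forall t i v,
  pairing (alpha i) (v *m F t) = scale_factor t i * pairing (alpha i) v.
Proof.
pose f0 i := if Q (alphav i) == 0 then alphav i else 0.
pose f1 i := if Q (alphav i) == 0 then 0 else alphav i.
pose V0 := <<codom f0>>%VS; pose V1 := <<codom f1>>%VS.
have V1V0 v : v \in (V1 + V0)%VS.
  have /span_coef[c ->] : v \in <<codom alphav>>%VS.
    by rewrite (coroots_span hD hss) memvf.
  apply: memv_suml => i _; have -> : alphav i = f1 i + f0 i.
    by rewrite /f0 /f1; case: eqP => _; rewrite (add0r, addr0).
  by rewrite memvZ // memv_add // memv_span // codom_f.
have V0P i v : Q (alphav i) != 0 -> v \in V0 -> pairing (alpha i) v = 0.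
  move=> qi /span_coef[c ->]; rewrite pairing_sumr big1 // => j _.
  rewrite pairingZr /f0; case: eqP => qj; last by rewrite pairing0r mulr0.
  by rewrite (pairing_eq0_sym hD hss (radical_orthogonal qj qi)) mulr0.
have V1P i v : Q (alphav i) = 0 -> v \in V1 -> pairing (alpha i) v = 0.
  move=> qi /span_coef[c ->]; rewrite pairing_sumr big1 // => j _.
  rewrite pairingZr /f1; case: eqP => [_|/eqP qj]; first by rewrite pairing0r mulr0.
  by rewrite radical_orthogonal ?mulr0.
pose p1 := addv_pi1 V1 V0.
exists (fun t => 1%:M + (t - 1) *: lin1_mx p1) => t i v.
rewrite mulmxDr mulmx1 -scalemxAr mul_rV_lin1 pairingDr pairingZr /scale_factor.
have p1V : p1 v \in V1 by apply: memv_pi1.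
case: eqP => [qi|/eqP qi]; first by rewrite (V1P _ _ qi p1V) mulr0 addr0 mul1r.
have pE : pairing (alpha i) (p1 v) = pairing (alpha i) v.
  rewrite -[in RHS](addv_pi1_pi2 (V1V0 v)) pairingDr [X in _ + X](V0P _ _ qi) ?addr0 //.
  exact: memv_pi2.
by rewrite pE; ring.
Qed.

(** From here on, [N] is the exponent of [coweight_exponent], and [F] the family
of maps of [scaling_exists], applied with [t] the ratio of two levels. *)
Variables (N : nat) (F : rat -> 'M[rat]_r).
Hypothesis N0 : (0 < N)%N.
Hypothesis NP :
  forall v, (forall i, pairing (alpha i) v \is a Num.int) -> Y (N%:R *: v).
Hypothesis FP : forall t i v,
  pairing (alpha i) (v *m F t) = scale_factor t i * pairing (alpha i) v.

(** [N] turns weights into cocharacters, the product clears the values of [Q], and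
the factor 2 is the pairing of a root with its coroot: evaluating the equation of
a fixed point at the coroot only gives a divisibility up to this factor. *)
Definition period : nat :=
  2 * N * \prod_(i | Q (alphav i) != 0) `|Q (alphav i)|.

Lemma period_gt0 : (0 < period)%N.
Proof. by rewrite !muln_gt0 N0 prodn_cond_gt0 // => i; rewrite absz_gt0. Qed.

Lemma period_dvd i : Q (alphav i) != 0 ->
  (2 * N * `|Q (alphav i)| %| period)%N.
Proof. by move=> qi; rewrite dvdn_mul // (bigD1 i) //= dvdn_mulr. Qed.

(** Symmetric in the two levels, so that the inverse of a scaling is covered by
the same lemmas. *)
Definition period_cong n m : Prop :=
  [/\ (0 < n)%N, (0 < m)%N & (m%:R - n%:R) / period%:R \is a @Num.int rat].

Lemma period_cong_sym n m : period_cong n m -> period_cong m n.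
Proof. by case=> n0 m0 nm; split=> //; rewrite -rpredN -mulNr opprB. Qed.

Lemma period_cong_add n : (0 < n)%N -> period_cong n (n + period).
Proof.
move=> n0; split; rewrite ?addn_gt0 ?n0 //.
by rewrite natrD addrAC subrr add0r divff ?rpred1 // pnatr_eq0 -lt0n period_gt0.
Qed.

Lemma scalingK t : t != 0 -> forall v, v *m F t *m F t^-1 = v.
Proof.
move=> t0 v; apply: (roots_separate hss) => i; rewrite !FP mulrA /scale_factor.
by case: ifP; rewrite ?mulr1 ?mulVf // mul1r.
Qed.

(** By the choice of the period, the displacement of [v] is [N] times a vector
with integral pairings against the roots, hence it is a cocharacter. *)
Lemma scaling_displacement n m v : period_cong n m ->
  (forall i, 2 * (pairing (alpha i) v * q i) / n%:R \is a Num.int) ->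
  Y (v *m F (m%:R / n%:R) - v).
Proof.
case=> n0 m0 nm vP; have n_neq0 : (n%:R : rat) != 0 by rewrite pnatr_eq0 -lt0n.
have N_neq0 : (N%:R : rat) != 0 by rewrite pnatr_eq0 -lt0n.
have scaleN (w : V) : w = N%:R *: (N%:R^-1 *: w) by rewrite scalerA divff ?scale1r.
rewrite [_ - v]scaleN; apply: NP => i.
rewrite pairingZr pairingBr FP /scale_factor.
case: eqP => [_|/eqP qi]; first by rewrite mul1r subrr mulr0 rpred0.
have q_neq0 : q i != 0 by rewrite intr_eq0.
have [k kE] := dvdnP (period_dvd qi).
have p_neq0 : (period%:R : rat) != 0 by rewrite pnatr_eq0 -lt0n period_gt0.
have perE : (period%:R : rat) = k%:R * (2 * N%:R * `|q i|).
  by rewrite kE !natrM natr_absz intr_norm.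
have k_neq0 : (k%:R : rat) != 0.
  by apply: contraNneq p_neq0 => k0; rewrite perE k0 mul0r.
have [s s_int sE] : exists2 s : rat, s \is a Num.int & `|q i| = s * q i.
  exists (Num.sg (q i)); last by rewrite normrEsg.
  by rewrite -intr_sg intr_int.
have -> : N%:R^-1 * (m%:R / n%:R * pairing (alpha i) v - pairing (alpha i) v) =
    (m%:R - n%:R) / period%:R * (k%:R * s)
      * (2 * (pairing (alpha i) v * q i) / n%:R).
  have s_neq0 : s != 0.
    by apply: contraNneq p_neq0 => s0; rewrite perE sE s0 mul0r !mulr0.
  by rewrite perE sE; field; rewrite N_neq0 k_neq0 s_neq0 q_neq0 n_neq0.
by apply: rpredM => //; apply: rpredM => //; apply: rpredM => //; apply: rpred_nat.
Qed.

Lemma YQn_scaling n m y : period_cong n m -> L n y -> L m (y *m F (m%:R / n%:R)).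
Proof.
move=> nm Ly; have [n0 m0 _] := nm.
have n_neq0 : (n%:R : rat) != 0 by rewrite pnatr_eq0 -lt0n.
have m_neq0 : (m%:R : rat) != 0 by rewrite pnatr_eq0 -lt0n.
have /(YQnE _ _ _ n0)[Yy yP] := Ly.
have YyF : Y (y *m F (m%:R / n%:R)).
  rewrite -[_ *m _](subrK y); apply: subgroupD => //.
  apply: scaling_displacement => // i; rewrite -mulrA rpredM ?rpred_nat //.
  exact: (YQn_pairing hD hQ hW).
apply/YQnE => //; split=> // z Yz.
have -> : (polar Q (y *m F (m%:R / n%:R)) z)%:~R =
    m%:R / n%:R * (polar Q y z)%:~R :> rat.
  apply: (polar_scale hD hss hQ hW) => // i; rewrite FP /scale_factor.
  by case: eqP => [->|_]; rewrite ?mulr0 // mulrA.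
have -> : m%:R / n%:R * (polar Q y z)%:~R / m%:R = (polar Q y z)%:~R / n%:R :> rat.
  by field; rewrite n_neq0 m_neq0.
exact: yP.
Qed.

Lemma YQn_scalingV n m y : period_cong n m ->
  L m (y *m F (m%:R / n%:R)) -> L n y.
Proof.
move=> nm; have [n0 m0 _] := nm.
have t0 : (m%:R / n%:R : rat) != 0.
  by rewrite mulf_neq0 ?invr_eq0 // pnatr_eq0 -lt0n.
move=> /(YQn_scaling (period_cong_sym nm)).
by rewrite -[n%:R / m%:R]invrK invf_div scalingK.
Qed.

(** The fixed points satisfy an equation on [y - rho], hence the scaling
centred at [rho]. *)
Lemma fixed_reps_scaling n m y : period_cong n m -> fixed_reps Delta Q n y ->
  fixed_reps Delta Q m ((y - rho) *m F (m%:R / n%:R) + rho).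
Proof.
move=> nm [Yy yP]; have [n0 m0 _] := nm.
have n_neq0 : (n%:R : rat) != 0 by rewrite pnatr_eq0 -lt0n.
have m_neq0 : (m%:R : rat) != 0 by rewrite pnatr_eq0 -lt0n.
have v_int i : pairing (alpha i) (y - rho) \is a Num.int.
  by rewrite pairingBr rpredB ?pairing_rho_int ?pairing_cochar_int.
have vP i z : Y z -> pairing (alpha i) (y - rho) * q i * pairing (alpha i) z / n%:R
    \is a Num.int.
  by have /(YQn_coroot hD hss hQ hW _ n0 (v_int i)) := yP i; apply.
set w := _ *m _.
have Yw : Y (w - (y - rho)).
  apply: scaling_displacement => // i.
  by rewrite [2 * _]mulrC -(root_coroot hD i) vP //; apply: coroot_cochar.
split.
  have -> : w + rho = w - (y - rho) + y by rewrite opprB addrA subrK.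
  exact: subgroupD.
move=> i; rewrite addrK; apply/(YQn_coroot hD hss hQ hW) => //.
  rewrite -[w](subrK (y - rho)) pairingDr rpredD //.
  exact: pairing_cochar_int.
move=> z Yz; rewrite FP /scale_factor; case: eqP => [->|_].
  by rewrite mulr0 !mul0r rpred0.
have := vP i z Yz; set a := pairing _ _; set b := pairing _ z.
by have -> : m%:R / n%:R * a * q i * b / m%:R = a * q i * b / n%:R by field; rewrite n_neq0 m_neq0.
Qed.

Lemma bW_leq_cong n m : period_cong n m -> (bW Q Delta n <= bW Q Delta m)%N.
Proof.
move=> nm; have [n0 m0 _] := nm; rewrite /bW !XQn_fixedE //.
apply: (leq_card_cosets (f := fun y => (y - rho) *m F (m%:R / n%:R) + rho)).
- exact: YQn_subgroup.
- exact: YQn_subgroup.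
- exact: finite_fixed_cosets.
- by move=> y; apply: fixed_reps_scaling.
move=> x y _ _; rewrite opprD addrACA subrr addr0 -mulmxBl opprB addrA subrK.
exact: YQn_scalingV.
Qed.

Lemma bW_periodic n : (0 < n)%N -> bW Q Delta n = bW Q Delta (n + period).
Proof.
move=> n0; have nm := period_cong_add n0; apply/eqP.
by rewrite eqn_leq !bW_leq_cong //; apply: period_cong_sym.
Qed.

Lemma n_root_scaling n i : (0 < n)%N ->
  (n_root Q (n + period) i)%:R =
    scale_factor ((n + period)%:R / n%:R) i * (n_root Q n i)%:R :> rat.
Proof.
move=> n0; rewrite /n_root /scale_factor; have n_neq0 : (n%:R : rat) != 0 by rewrite pnatr_eq0 -lt0n.
case: eqP => [->|/eqP qi].
  by rewrite absz0 !gcdn0 !divnn addn_gt0 n0 mul1r.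
rewrite !natf_div ?dvdn_gcdl //.
have -> : gcdn (n + period) `|Q (alphav i)| = gcdn n `|Q (alphav i)|.
  have /dvdnP[k ->] : (`|Q (alphav i)| %| period)%N.
    exact: dvdn_trans (dvdn_mull _ (dvdnn _)) (period_dvd qi).
  by rewrite gcdnC addnC gcdnMDl gcdnC.
by rewrite mulrA divfK.
Qed.

Lemma scaling_coroot t i : alphav i *m F t = scale_factor t i *: alphav i.
Proof.
apply: (roots_separate hss) => j; rewrite FP pairingZr /scale_factor.
case: eqP => [qj|/eqP qj]; case: eqP => [qi|/eqP qi] //.
  by rewrite (radical_orthogonal qj qi) !mulr0.
by rewrite (pairing_eq0_sym hD hss (radical_orthogonal qi qj)) !mulr0.
Qed.

Lemma scaling_root t i : alpha i *m (F t)^T = scale_factor t i *: alpha i.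
Proof.
apply: pairing_nondegenerate => z.
by rewrite pairingC -pairing_tr pairingC FP pairingZl.
Qed.

Lemma dual_datum_periodic n : (0 < n)%N ->
  rootDatum_iso (dual_datum D Q n) (dual_datum D Q (n + period)).
Proof.
move=> n0; have nm := period_cong_add n0; set m := (n + period)%N in nm *.
have mn := period_cong_sym nm; have [_ m0 _] := nm.
pose t : rat := m%:R / n%:R; have tV : t^-1 = n%:R / m%:R by rewrite /t invf_div.
have t0 : t != 0 by rewrite mulf_neq0 ?invr_eq0 // pnatr_eq0 -lt0n.
have LF x : L n x -> L m (x *m F t) by apply: YQn_scaling.
have LFV x : L m x -> L n (x *m F t^-1) by rewrite tV; apply: YQn_scaling.
have FK v : v *m F t *m F t^-1 = v by apply: scalingK.
have FVK v : v *m F t^-1 *m F t = v 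
  by have := @scalingK t^-1 _ v; rewrite invrK invr_eq0; apply.
have FTK y : y *m (F t)^T *m (F t^-1)^T = y.
  by apply: pairing_nondegenerate => z; rewrite !(pairingC _ z) -!pairing_tr FVK.
have FTVK y : y *m (F t^-1)^T *m (F t)^T = y.
  by apply: pairing_nondegenerate => z; rewrite !(pairingC _ z) -!pairing_tr FK.
exists (fun x => x *m F t), (fun y => y *m (F t)^T), id; split.
- split=> [x|x y _ _ xy|y Ly]; first exact: LF.
    by rewrite -[x]FK xy FK.
  by exists (y *m F t^-1); [apply: LFV|apply: FVK].
- split=> [y yP x Lx|x y _ _ xy|y yP].
  + by rewrite -pairing_tr yP //; apply: LF.
  + by rewrite -[x]FTK xy FTK.
  exists (y *m (F t^-1)^T); last exact: FTVK.
  by move=> x Lx; rewrite -pairing_tr yP //; apply: LFV.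
- by exists id.
split=> [x x' _ _|y y' _ _|x y _ _|i|i] /=.
- exact: mulmxDl.
- exact: mulmxDl.
- exact: pairing_tr.
- by rewrite -scalemxAl scaling_coroot scalerA n_root_scaling // mulrC.
rewrite -scalemxAl scaling_root scalerA n_root_scaling // -/t invfM.
rewrite mulrAC mulVf ?mul1r // /scale_factor.
by case: ifP; rewrite ?oner_neq0.
Qed.

End Periodicity.

Theorem theorem1p3 (r : nat) (D : rootDatum r) (Delta : {set rootIdx D})
    (Q : 'rV[rat]_r -> int)
    (hD : is_root_datum D) (hDelta : is_base Delta) (hss : semisimple D)
    (hQ : is_quadratic_form D Q) (hW : weyl_invariant D Q) :
  (forall n : nat, (1 <= n)%N ->
     (bW Q Delta n <= pi1_order (dual_datum D Q n))%N) /\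
  (simply_connected D ->
     forall n : nat, (1 <= n)%N -> (bW Q Delta n <= 1)%N) /\
  (adjoint_type D ->
     forall n : nat, (1 <= n)%N ->
       bW Q Delta n = pi1_order (dual_datum D Q n)) /\
  (irreducible D ->
     exists2 c : nat, (1 <= c)%N &
       forall n : nat, (1 <= n)%N -> bW Q Delta n = bW Q Delta (n + c)%N) /\
  (exists2 c' : nat, (1 <= c')%N &
     forall n : nat, (1 <= n)%N ->
       rootDatum_iso (dual_datum D Q n) (dual_datum D Q (n + c')%N)) /\
  (irreducible D ->
     exists2 c : nat, (1 <= c)%N &
       forall n : nat, (1 <= n)%N ->
         bW Q Delta n = bW Q Delta (n + c)%N /\
         rootDatum_iso (dual_datum D Q n) (dual_datum D Q (n + c)%N)).
Proof.
have [N N0 NP] := coweight_exponent hD hss.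
have [F FP] := scaling_exists hD hss hQ hW.
have c0 := @period_gt0 _ _ Q _ N0.
have bWc n n0 := bW_periodic hD hDelta hss hQ hW N0 NP FP (n := n) n0.
have dualc n n0 := dual_datum_periodic hD hss hQ hW N0 NP FP (n := n) n0.
split; first by move=> n; apply: bW_le_pi1.
split; first by move=> sc n; apply: bW_simply_connected.
split; first by move=> ad n; apply: bW_adjoint.
by split; [|split] => *; exists (period D Q N) => // n n0; split; auto.
Qed.
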